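(* Let $\mathbb G$ be an affine group scheme of finite type over $k$ and let $\{X_i\}_{i\ge 0}$ be an ascending, converging sequence of subspaces of $\mathcal O(\mathbb G)$. Then a $\mathbb G$-module $L$ is injective (in $Mod(\mathbb G)$) if and only if $L_{X_i}$ is an injective object of $Mod(\mathbb G,X_i)$ for all $i\geq 0$.
   Context: $k$ is a field of characteristic $p>0$. $Mod(\mathbb G)$ is the abelian category of $\mathbb G$-modules, i.e. right $\mathcal O(\mathbb G)$-comodules, with coaction $\Delta_M: M\to M\otimes\mathcal O(\mathbb G)$. For a $k$-subspace $X\subset\mathcal O(\mathbb G)$, an $X$-comodule is a $\mathbb G$-module $M$ with $\Delta_M(M)\subset M\otimes X$; $Mod(\mathbb G,X)\subset Mod(\mathbb G)$ is the full (abelian) subcategory of $X$-comodules. For a $\mathbb G$-module $M$, $M_X\subset M$ is the union of all $\mathbb G$-submodules of $M$ which are $X$-comodules; it is the largest $X$-comodule contained in $M$. A sequence $\{X_i\}_{i\ge0}$ of subspaces of $\mathcal O(\mathbb G)$ is ascending, converging if $X_i\subset X_{i+1}$ for all $i\geq 0$ and $\bigcup_{i\ge0}X_i=\mathcal O(\mathbb G)$. *)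

(* Defs.v *)
From HB Require Import structures.
From mathcomp Require Import all_boot all_order all_algebra.
From mathcomp Require Import boolp classical_sets.

Set Implicit Arguments.
Unset Strict Implicit.
Unset Printing Implicit Defensive.

Import GRing.Theory.
Local Open Scope ring_scope.
Local Open Scope quotient_scope.

Notation bilin f := (bilinear_for *:%R *:%R f).

Section TensorProduct.
Variables (k : fieldType) (U V : lmodType k).

Definition bsum (W : nmodType) (b : U -> V -> W) (s : seq (U * V)) : W :=
  \sum_(p <- s) b p.1 p.2.

(* [U ⊗ V] is the set of formal sums of pairs, two of them being identified
   when no bilinear map separates them; [tlift_tens] and [tlift_uniq] below
   are the universal property. *)
Definition tens_rel (s t : seq (U * V)) : bool :=
  `[< forall (W : lmodType k) (b : U -> V -> W), bilin b ->
        bsum b s = bsum b t >].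

Lemma tens_relP s t :
  reflect (forall (W : lmodType k) (b : U -> V -> W), bilin b ->
             bsum b s = bsum b t) (tens_rel s t).
Proof. exact: asboolP. Qed.

Lemma tens_rel_refl : reflexive tens_rel.
Proof. by move=> s; apply/tens_relP. Qed.

Lemma tens_rel_sym : symmetric tens_rel.
Proof. by move=> s t; apply/tens_relP/tens_relP => h W b /h ->. Qed.

Lemma tens_rel_trans : transitive tens_rel.
Proof.
by move=> t s r /tens_relP h /tens_relP h'; apply/tens_relP => W b bb; rewrite h ?h'.
Qed.

Canonical tens_equiv :=
  EquivRel tens_rel tens_rel_refl tens_rel_sym tens_rel_trans.

Definition tensor := {eq_quot tens_rel}.
HB.instance Definition _ := Choice.on tensor.
HB.instance Definition _ := EqQuotient.on tensor.

Definition tens (u : U) (v : V) : tensor := \pi_tensor [:: (u, v)].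

(* The map induced by [b]; it has no meaning unless [b] is bilinear. *)
Definition tlift (W : nmodType) (b : U -> V -> W) (x : tensor) : W :=
  bsum b (repr x).

Lemma bsum_repr (W : lmodType k) (b : U -> V -> W) s : bilin b ->
  bsum b (repr (\pi_tensor s)) = bsum b s.
Proof.
move=> bb; have /eqmodP /tens_relP -> // := reprK (\pi_tensor s).
Qed.

Lemma eq_tensor (x y : tensor) :
  (forall (W : lmodType k) (b : U -> V -> W), bilin b ->
     tlift b x = tlift b y) -> x = y.
Proof.
by move=> h; rewrite -[x]reprK -[y]reprK; apply/eqmodP/tens_relP.
Qed.

Let zero_tens : tensor := \pi_tensor [::].
Let add_tens (x y : tensor) : tensor := \pi_tensor (repr x ++ repr y).
Let scale_tens (a : k) (x : tensor) : tensor :=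
  \pi_tensor [seq (a *: p.1, p.2) | p <- repr x].
Let opp_tens (x : tensor) : tensor := scale_tens (- 1) x.

Section Lift.
Variables (W : lmodType k) (b : U -> V -> W).
Hypothesis bb : bilin b.

Lemma bilinZl a u v : b (a *: u) v = a *: b u v.
Proof. by have := scalable_linear (bb.1 v); apply. Qed.
Lemma bilinZr a u v : b u (a *: v) = a *: b u v.
Proof. by have := scalable_linear (bb.2 u); apply. Qed.
Lemma bilinDl u u' v : b (u + u') v = b u v + b u' v.
Proof. by have := bb.1 v 1 u u'; rewrite /= !scale1r. Qed.
Lemma bilinDr u v v' : b u (v + v') = b u v + b u v'.
Proof. by have := bb.2 u 1 v v'; rewrite /= !scale1r. Qed.

Let lift0 : tlift b zero_tens = 0.
Proof. by rewrite /tlift bsum_repr // /bsum big_nil. Qed.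
Let liftD x y : tlift b (add_tens x y) = tlift b x + tlift b y.
Proof. by rewrite /tlift bsum_repr // /bsum big_cat. Qed.
Let liftZ a x : tlift b (scale_tens a x) = a *: tlift b x.
Proof.
rewrite /tlift bsum_repr // /bsum big_map scaler_sumr.
by apply: eq_bigr => p _ /=; rewrite bilinZl.
Qed.

Definition tlift_morph := (lift0, liftD, liftZ).
End Lift.

Let addA : associative add_tens.
Proof. by move=> x y z; apply: eq_tensor => W b bb; rewrite !tlift_morph // addrA. Qed.
Let addC : commutative add_tens.
Proof. by move=> x y; apply: eq_tensor => W b bb; rewrite !tlift_morph // addrC. Qed.
Let add0 : left_id zero_tens add_tens.
Proof. by move=> x; apply: eq_tensor => W b bb; rewrite !tlift_morph // add0r. Qed.
Let addN : left_inverse zero_tens opp_tens add_tens.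
Proof.
by move=> x; apply: eq_tensor => W b bb; rewrite !tlift_morph // scaleN1r addNr.
Qed.

HB.instance Definition _ := GRing.isZmodule.Build tensor addA addC add0 addN.

Let scaleA a c (x : tensor) : scale_tens a (scale_tens c x) = scale_tens (a * c) x.
Proof. by apply: eq_tensor => W b bb; rewrite !tlift_morph // scalerA. Qed.
Let scale1 : left_id 1 scale_tens.
Proof. by move=> x; apply: eq_tensor => W b bb; rewrite !tlift_morph // scale1r. Qed.
Let scaleDr : right_distributive scale_tens +%R.
Proof.
by move=> a x y; apply: eq_tensor => W b bb; rewrite !tlift_morph // scalerDr.
Qed.
Let scaleDl (x : tensor) : {morph scale_tens^~ x : a c / a + c}.
Proof.
by move=> a c; apply: eq_tensor => W b bb; rewrite !tlift_morph // scalerDl.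
Qed.

HB.instance Definition _ :=
  GRing.Zmodule_isLmodule.Build k tensor scaleA scale1 scaleDr scaleDl.

Lemma tlift_tens (W : lmodType k) (b : U -> V -> W) u v : bilin b ->
  tlift b (tens u v) = b u v.
Proof. by move=> bb; rewrite /tlift bsum_repr // /bsum big_seq1. Qed.

Lemma tlift_linear (W : lmodType k) (b : U -> V -> W) : bilin b ->
  linear (tlift b).
Proof. by move=> bb a x y; rewrite (tlift_morph bb) (tlift_morph bb). Qed.

Lemma tens_bilin : bilin tens.
Proof.
split=> [v|u] a x y; apply: eq_tensor => W b bb;
  rewrite (tlift_linear bb) !tlift_tens //.
  by rewrite bilinDl // bilinZl.
by rewrite bilinDr // bilinZr.
Qed.

Lemma tens0l v : tens 0 v = 0.
Proof. by have := bilinZl tens_bilin 0 0 v; rewrite !scale0r. Qed.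

Lemma tensE (x : tensor) : x = \sum_(p <- repr x) tens p.1 p.2.
Proof.
apply: eq_tensor => W b bb.
have bD : {morph tlift b : x y / x + y} by move=> y z; rewrite (tlift_morph bb).
have b0 : tlift b 0 = 0 by rewrite (tlift_morph bb).
rewrite (big_morph _ bD b0); apply: eq_bigr => p _; exact/esym/tlift_tens.
Qed.

Lemma tlift_uniq (W : lmodType k) (f g : {linear tensor -> W}) :
  (forall u v, f (tens u v) = g (tens u v)) -> f =1 g.
Proof. by move=> fg x; rewrite [x]tensE !linear_sum; apply: eq_bigr. Qed.

Lemma tens_ind (P : tensor -> Prop) :
  P 0 -> (forall u v, P (tens u v)) -> (forall x y, P x -> P y -> P (x + y)) ->
  forall x, P x.
Proof.
by move=> P0 Pt PD x; rewrite [x]tensE; elim/big_ind: _ => // p _; apply: Pt.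
Qed.

(* The image of [N ⊗ X] in [U ⊗ V], for subspaces [N] of [U] and [X] of [V]. *)
Definition tens_in (N : {pred U}) (X : {pred V}) (x : tensor) : Prop :=
  exists2 s : seq (U * V), {in s, forall p, p.1 \in N /\ p.2 \in X} &
    x = \sum_(p <- s) tens p.1 p.2.

End TensorProduct.

Section TensorMaps.
Variable k : fieldType.
Implicit Types U V W : lmodType k.

Definition tmap U U' V V' (f : U -> U') (g : V -> V') :
  tensor U V -> tensor U' V' := tlift (fun u v => tens (f u) (g v)).

Definition tassoc U V W : tensor (tensor U V) W -> tensor U (tensor V W) :=
  tlift (fun x w => tlift (fun u v => tens u (tens v w)) x).

Lemma bilin_comp U U' V V' W (b : U' -> V' -> W) (f : U -> U') (g : V -> V') :
  linear f -> linear g -> bilin b -> bilin (fun u v => b (f u) (g v)).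
Proof.
move=> lf lg bb; split=> [v|u] a x y /=; rewrite ?lf ?lg /=.
  by rewrite (bilinDl bb) (bilinZl bb).
by rewrite (bilinDr bb) (bilinZr bb).
Qed.

Lemma bilin_tlift U V U' V' W (b : U -> V -> U' -> V' -> W) x :
  (forall u' v', bilin (fun u v => b u v u' v')) ->
  bilin (fun u v => tlift (b u v) x).
Proof.
move=> bb; split=> [v|u] a y z; rewrite /tlift /bsum /= scaler_sumr -big_split;
  apply: eq_bigr => p _ /=; case: (bb p.1 p.2) => l r.
  exact: (l v).
exact: (r u).
Qed.

Lemma bilin_tens2 U U' V V' (f : {linear U -> U'}) (g : {linear V -> V'}) :
  bilin (fun u v => tens (f u) (g v)).
Proof. exact: bilin_comp (linearP f) (linearP g) (tens_bilin _ _). Qed.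

HB.instance Definition _ U U' V V' (f : {linear U -> U'}) (g : {linear V -> V'}) :=
  GRing.isLinear.Build k (tensor U V) (tensor U' V') *:%R (tmap f g)
    (tlift_linear (bilin_tens2 f g)).

Lemma bilin_tassoc U V W :
  bilin (fun (x : tensor U V) (w : W) => tlift (fun u v => tens u (tens v w)) x).
Proof.
have bb (w : W) : bilin (fun (u : U) (v : V) => tens u (tens v w)).
  split=> [v|u] a x y /=; first exact: ((tens_bilin _ _).1 _).
  by rewrite ((tens_bilin _ _).1 w) /= (bilinDr (tens_bilin _ _)) (bilinZr (tens_bilin _ _)).
split=> [w|x] a; first exact: tlift_linear.
move=> v w /=; rewrite /tlift /bsum scaler_sumr -big_split; apply: eq_bigr => p _ /=.
by rewrite ((tens_bilin _ _).2 p.2) /= (bilinDr (tens_bilin _ _)) (bilinZr (tens_bilin _ _)).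
Qed.

HB.instance Definition _ U V W :=
  GRing.isLinear.Build k (tensor (tensor U V) W) (tensor U (tensor V W)) *:%R
    (@tassoc U V W) (tlift_linear (bilin_tassoc U V W)).

Lemma tmap_tens U U' V V' (f : {linear U -> U'}) (g : {linear V -> V'}) u v :
  tmap f g (tens u v) = tens (f u) (g v).
Proof. exact: tlift_tens (bilin_tens2 f g). Qed.

Lemma tassoc_tens U V W (u : U) (v : V) (w : W) :
  tassoc (tens (tens u v) w) = tens u (tens v w).
Proof.
rewrite /tassoc (tlift_tens _ _ (bilin_tassoc U V W)) tlift_tens //.
split=> [v'|u'] a x y /=; first exact: ((tens_bilin _ _).1 _).
by rewrite ((tens_bilin _ _).1 w) /= (bilinDr (tens_bilin _ _)) (bilinZr (tens_bilin _ _)).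
Qed.

Lemma linear_tlift U V W W' (h : {linear W -> W'}) (b : U -> V -> W) x :
  h (tlift b x) = tlift (fun u v => h (b u v)) x.
Proof. by rewrite /tlift /bsum linear_sum. Qed.

Lemma tlift_tmap U U' V V' W (b : U' -> V' -> W) (f : {linear U -> U'})
    (g : {linear V -> V'}) x : bilin b ->
  tlift b (tmap f g x) = tlift (fun u v => b (f u) (g v)) x.
Proof.
move=> bb; have bD : {morph tlift b : x y / x + y}.
  by move=> y z; have := tlift_linear bb 1 y z; rewrite /= !scale1r.
have b0 : tlift b 0 = 0.
  by apply: (addIr (tlift b 0)); rewrite -bD !add0r.
rewrite {1}/tmap {2}/tlift /bsum (big_morph _ bD b0).
by apply: eq_bigr => p _; rewrite tlift_tens.
Qed.

Lemma tmap_comp U U' U'' V V' V'' (f : {linear U -> U'}) (g : {linear V -> V'})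
    (f' : {linear U' -> U''}) (g' : {linear V' -> V''}) x :
  tmap f' g' (tmap f g x) = tmap (f' \o f) (g' \o g) x.
Proof. exact: tlift_tmap (bilin_tens2 f' g'). Qed.

Lemma tmap_id U V (x : tensor U V) : tmap idfun idfun x = x.
Proof. by rewrite [RHS]tensE. Qed.

Lemma eq_tmap U U' V V' (f f' : U -> U') (g g' : V -> V') :
  f =1 f' -> g =1 g' -> tmap f g =1 tmap f' g'.
Proof. by move=> ff gg x; apply: eq_bigr => p _; rewrite ff gg. Qed.

Lemma tassoc_nat U U' V W (f : {linear U -> U'}) (x : tensor (tensor U V) W) :
  tassoc (tmap (tmap f idfun) idfun x) = tmap f idfun (tassoc x).
Proof.
have aD U0 (y z : tensor (tensor U0 V) W) : tassoc (y + z) = tassoc y + tassoc z.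
  exact: linearD.
have tD (y z : tensor U V) : tmap f idfun (y + z) = tmap f idfun y + tmap f idfun z :> tensor U' V.
  exact: linearD.
elim/tens_ind: x => [|y w|x y hx hy]; first by rewrite !linear0.
  rewrite tmap_tens /=; elim/tens_ind: y => [|u v|x y hx hy].
  - by rewrite linear0 !tens0l !linear0.
  - by rewrite !(tmap_tens, tassoc_tens).
  - by rewrite tD !(bilinDl (tens_bilin _ _)) !aD hx hy linearD.
by rewrite linearD !aD hx hy linearD.
Qed.

End TensorMaps.

Section TensorAlgebra.
Variables (k : fieldType) (A B : comAlgType k).
Local Notation T := (tensor A B).

Let mul_tens (x y : T) : T :=
  tlift (fun a b => tlift (fun c d => tens (a * c) (b * d)) y) x.
Let one_tens : T := tens 1 1.

Let bilin_mul1 (a : A) (b : B) : bilin (fun c d => tens (a * c) (b * d)).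
Proof.
apply: (bilin_comp _ _ (tens_bilin A B)) => t x y /=;
  by rewrite mulrDr scalerAr.
Qed.

Let bilin_mul2 (y : T) : bilin (fun a b => tlift (fun c d => tens (a * c) (b * d)) y).
Proof.
apply: bilin_tlift => c d.
apply: (bilin_comp _ _ (tens_bilin A B)) => t u v /=;
  by rewrite mulrDl scalerAl.
Qed.

Let mul_tensE a b c d : mul_tens (tens a b) (tens c d) = tens (a * c) (b * d).
Proof. by rewrite /mul_tens (tlift_tens _ _ (bilin_mul2 _)) (tlift_tens _ _ (bilin_mul1 _ _)). Qed.

Let mulDl : left_distributive mul_tens +%R.
Proof.
move=> x y z; have := tlift_linear (bilin_mul2 z) 1 x y.
by rewrite /= !scale1r.
Qed.

Let mulDr : right_distributive mul_tens +%R.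
Proof.
move=> x y z; rewrite /mul_tens.
rewrite /tlift -/(tlift _) {1 3 5}/bsum -big_split; apply: eq_bigr => p _ /=.
have := tlift_linear (bilin_mul1 p.1 p.2) 1 y z.
by rewrite /= !scale1r.
Qed.

Let mul0 : left_zero 0 mul_tens.
Proof. by move=> x; apply: (addIr (mul_tens 0 x)); rewrite -mulDl !add0r. Qed.
Let mulx0 : right_zero 0 mul_tens.
Proof. by move=> x; apply: (addIr (mul_tens x 0)); rewrite -mulDr !add0r. Qed.

Let mulA : associative mul_tens.
Proof.
move=> x y z; elim/tens_ind: x => [|a b|x x' hx hx']; first by rewrite !mul0.
  elim/tens_ind: y => [|c d|y y' hy hy']; first by rewrite !(mul0, mulx0).
    elim/tens_ind: z => [|e f|z z' hz hz']; first by rewrite !mulx0.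
      by rewrite !mul_tensE !mulrA.
    by rewrite !mulDr hz hz'.
  by rewrite !(mulDl, mulDr) hy hy'.
by rewrite !mulDl hx hx'.
Qed.

Let mulC : commutative mul_tens.
Proof.
move=> x y; elim/tens_ind: x => [|a b|x x' hx hx']; first by rewrite mul0 mulx0.
  elim/tens_ind: y => [|c d|y y' hy hy']; first by rewrite mul0 mulx0.
    by rewrite !mul_tensE mulrC [b * _]mulrC.
  by rewrite mulDl mulDr hy hy'.
by rewrite mulDl mulDr hx hx'.
Qed.

Let mul1 : left_id one_tens mul_tens.
Proof.
elim/tens_ind=> [|a b|x x' hx hx']; first by rewrite mulx0.
  by rewrite mul_tensE !mul1r.
by rewrite mulDr hx hx'.
Qed.

HB.instance Definition _ :=
  GRing.Zmodule_isComPzRing.Build (tensor A B) mulA mulC mul1 mulDl.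

Lemma tens_mul (a c : A) (b d : B) : tens a b * tens c d = tens (a * c) (b * d).
Proof. exact: mul_tensE. Qed.

Lemma tens_one : 1 = tens 1 1 :> tensor A B.
Proof. by []. Qed.

End TensorAlgebra.

(* An affine group scheme over [k], as its coordinate Hopf algebra. *)
Record affineGroup (k : fieldType) := AffineGroup {
  coordRing : comAlgType k;
  comul : {lrmorphism coordRing -> tensor coordRing coordRing};
  counit : {lrmorphism coordRing -> k^o};
  antipode : {lrmorphism coordRing -> coordRing};
  comulA : forall f, tassoc (tmap comul idfun (comul f)) = tmap idfun comul (comul f);
  counitl : forall f, tlift (fun a b => counit a *: b) (comul f) = f;
  counitr : forall f, tlift (fun a b => counit b *: a) (comul f) = f;
  antipodel : forall f, tlift (fun a b => antipode a * b) (comul f) = (counit f)%:A;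
  antipoder : forall f, tlift (fun a b => a * antipode b) (comul f) = (counit f)%:A
}.

Definition finite_type (k : fieldType) (G : affineGroup k) : Prop :=
  exists s : seq (coordRing G), forall B : subalgClosed (coordRing G),
    {subset s <= B} -> forall f, f \in B.

Record gmodule (k : fieldType) (G : affineGroup k) := GModule {
  gmod_sort :> lmodType k;
  coact : {linear gmod_sort -> tensor gmod_sort (coordRing G)};
  coactA : forall m,
    tassoc (tmap coact idfun (coact m)) = tmap idfun (comul G) (coact m);
  coact_counit : forall m, tlift (fun n f => counit G f *: n) (coact m) = m
}.

Record ghom (k : fieldType) (G : affineGroup k) (M N : gmodule G) := GHom {
  ghom_fun :> {linear M -> N};
  ghom_coact : forall m, coact N (ghom_fun m) = tmap ghom_fun idfun (coact M m)
}.

Section Subspaces.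
Variables (k : fieldType) (V : lmodType k).

Definition subsp (N : submodClosed V) : Type := {v : V | v \in N}.

Section Instances.
Variable N : submodClosed V.
HB.instance Definition _ := SubChoice.on (subsp N).
HB.instance Definition _ := [SubChoice_isSubLmodule of subsp N by <:].
End Instances.

Definition zero_subsp : {pred V} := pred1 0.
Fact zero_subsp_closed : subsemimod_closed zero_subsp.
Proof.
split; first by split; rewrite ?inE // => x y /eqP -> /eqP ->; rewrite addr0 inE.
by move=> a x /eqP ->; rewrite scaler0 inE.
Qed.
HB.instance Definition _ :=
  GRing.isSubmodClosed.Build k V zero_subsp zero_subsp_closed.

Definition add_subsp (N N' : {pred V}) : {pred V} :=
  fun v => `[< exists n n', [/\ n \in N, n' \in N' & v = n + n'] >].
Fact add_subsp_closed (N N' : submodClosed V) :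
  subsemimod_closed (add_subsp N N').
Proof.
split; first split.
- by apply/asboolP; exists 0, 0; rewrite !rpred0 addr0.
- move=> _ _ /asboolP[n [n' [Nn Nn' ->]]] /asboolP[m [m' [Nm Nm' ->]]].
  by apply/asboolP; exists (n + m), (n' + m'); rewrite !rpredD // addrACA.
- move=> a _ /asboolP[n [n' [Nn Nn' ->]]].
  by apply/asboolP; exists (a *: n), (a *: n'); rewrite !rpredZ // scalerDr.
Qed.
HB.instance Definition _ (N N' : submodClosed V) :=
  GRing.isSubmodClosed.Build k V (add_subsp N N') (add_subsp_closed N N').

Lemma subsp_retract (N : submodClosed V) :
  exists r : {linear V -> subsp N}, forall n : subsp N, r (val n) = n.
Proof.
pose P (K : set V) := (forall a x y, K x -> K y -> K (a *: x + y)) /\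
  (forall x, K x -> x \in N -> x = 0).
have [F FP Ftot|K [[Klin KN] Kmax]] := @Zorn_bigcup V P.
  split=> [a x y [X FX Xx] [Y FY Yy]|x [X FX Xx]]; last exact: (FP _ FX).2.
  have [XY|YX] := Ftot _ _ FX FY.
    by exists Y => //; apply: (FP _ FY).1 => //; apply: XY.
  by exists X => //; apply: (FP _ FX).1 => //; apply: YX.
have K0 : K 0.
  case: (pselect (K 0)) => // nK0.
  have Kempty x : ~ K x.
    move=> Kx; apply: nK0; rewrite -(addNr x) -scaleN1r; exact: Klin.
  exfalso; apply: (Kmax [set 0]%classic); last first.
    by split=> [a x y -> ->|x -> //]; rewrite scaler0 addr0.
  split; first by move=> x /Kempty.
  by move=> /(_ 0 erefl) /Kempty.
have KZ a x : K x -> K (a *: x) by move=> Kx; rewrite -[_ *: x]addr0; apply: Klin.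
have KD x y : K x -> K y -> K (x + y) by move=> Kx; rewrite -[x in x + _]scale1r; apply: Klin.
have dec v : exists n : subsp N, K (v - val n).
  apply: contrapT => nv.
  have nKv : ~ K v by move=> Kv; apply: nv; exists 0; rewrite (raddf0 \val) subr0.
  pose K' := [set w | exists a x, K x /\ w = a *: v + x]%classic.
  apply: (Kmax K').
    split; first by move=> x Kx; exists 0, x; rewrite scale0r add0r.
    move=> /(_ v) K'v; apply: nKv; apply: K'v.
    by exists 1, 0; rewrite scale1r addr0.
  split=> [c _ _ [a [x [Kx ->]]] [b [y [Ky ->]]]|_ [a [x [Kx ->]]] Nw].
    exists (c * a + b), (c *: x + y); split; first exact: Klin.
    by rewrite scalerDr scalerA scalerDl addrACA.
  have [a0|a0] := eqVneq a 0.
    by move: Nw; rewrite a0 scale0r add0r; apply: KN.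
  exfalso; apply: nv; exists (a^-1 *: (exist (fun v => v \in N) _ Nw : subsp N)).
  rewrite (linearZ_LR \val) /= scalerDr scalerA mulVf // scale1r opprD addrA subrr add0r.
  by rewrite -scaleN1r; exact: (KZ _ _ (KZ _ _ Kx)).
have [r rP] := choice dec.
have rU v (n : subsp N) : K (v - val n) -> r v = n.
  move=> Kvn; apply/val_inj/eqP; rewrite -subr_eq0; apply/eqP/KN.
    have -> : val (r v) - val n = -1 *: (v - val (r v)) + (v - val n).
      by rewrite scaleN1r opprB addrA subrK.
    exact: Klin.
  by rewrite -scaleN1r rpredD ?rpredZ ?(valP (r v)) ?(valP n).
have rlin : linear r.
  move=> a x y; apply: rU; rewrite (linearP \val) /=.
  have -> : a *: x + y - (a *: val (r x) + val (r y)) =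
            a *: (x - val (r x)) + (y - val (r y)).
    by rewrite scalerBr opprD addrACA.
  exact: Klin.
exists (HB.pack_for {linear V -> subsp N} r (GRing.isLinear.Build k _ _ _ r rlin)).
by move=> n; apply: rU; rewrite subrr.
Qed.

End Subspaces.

Section Submodules.
Variables (k : fieldType) (G : affineGroup k) (M : gmodule G).
Local Notation O := (coordRing G).

Definition gstable (N : {pred M}) : Prop :=
  {in N, forall m, tens_in N (predT : {pred O}) (coact M m)}.

Section SubModule.
Variables (N : submodClosed M) (hN : gstable N).

Let r : {linear M -> subsp N} := projT1 (cid (subsp_retract N)).
Let rK (n : subsp N) : r (val n) = n.
Proof. exact: (projT2 (cid (subsp_retract N))). Qed.

Lemma tmap_val_inj (V : lmodType k) :
  injective (tmap (\val : subsp N -> M) (idfun : V -> V)).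
Proof.
apply: (can_inj (g := tmap r idfun)) => x; rewrite tmap_comp.
by rewrite -[RHS]tmap_id; apply: eq_tmap => // n; apply: rK.
Qed.

Lemma tmap_val_retract (V : lmodType k) (X : {pred V}) x : tens_in N X x ->
  tmap (\val : subsp N -> M) (idfun : V -> V) (tmap r idfun x) = x.
Proof.
case=> s sN ->; rewrite (linear_sum (tmap r _)) (linear_sum (tmap \val _)).
apply: eq_big_seq => p ps /=.
rewrite (tmap_tens r idfun) (tmap_tens \val idfun) /=; have [Np _] := sN _ ps.
by have := rK (exist (fun m => m \in N) _ Np); move=> /= ->.
Qed.

Fact sub_coact_exists : exists d : {linear subsp N -> tensor (subsp N) O},
  forall n, tmap \val idfun (d n) = coact M (val n).
Proof.
exists (tmap r (idfun : {linear O -> O}) \o coact M \o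
          (\val : {linear subsp N -> M})) => n.
by apply: tmap_val_retract; apply: hN; apply: valP.
Qed.

(* The coaction of [M] restricted to the submodule [N]: by [tmap_val_inj],
   [sub_coactE] determines it. *)
Definition sub_coact : {linear subsp N -> tensor (subsp N) O} :=
  projT1 (cid sub_coact_exists).

Lemma sub_coactE n : tmap \val idfun (sub_coact n) = coact M (val n).
Proof. exact: (projT2 (cid sub_coact_exists)). Qed.

Fact sub_coactA n :
  tassoc (tmap sub_coact idfun (sub_coact n)) =
  tmap idfun (comul G) (sub_coact n).
Proof.
apply: tmap_val_inj; rewrite -tassoc_nat.
transitivity (tassoc (tmap (coact M) idfun (coact M (val n)))).
  congr tassoc; rewrite -sub_coactE.
  transitivity (tmap (tmap \val idfun \o sub_coact) idfun (sub_coact n)).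
    exact: tmap_comp.
  transitivity (tmap (coact M \o \val) idfun (sub_coact n)).
    by apply: eq_tmap => // m; apply: sub_coactE.
  exact/esym/tmap_comp.
rewrite coactA -sub_coactE.
transitivity (tmap (\val : subsp N -> M) (comul G) (sub_coact n)).
  exact: tmap_comp.
exact/esym/tmap_comp.
Qed.

Fact sub_coact_counit n :
  tlift (fun m f => counit G f *: m) (sub_coact n) = n.
Proof.
apply: val_inj; rewrite (linear_tlift (\val : {linear subsp N -> M})).
rewrite -[RHS](coact_counit (val n)) -sub_coactE.
have bb : bilin (fun (m : M) (f : O) => counit G f *: m).
  split=> [f|m] a x y /=; first by rewrite scalerDr !scalerA mulrC.
  by rewrite linearP /= scalerDl scalerA.
rewrite [RHS](tlift_tmap _ _ _ bb); exact: eq_bigr.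
Qed.

Definition gsub : gmodule G := GModule sub_coactA sub_coact_counit.
End SubModule.

End Submodules.

Section XComodules.
Variables (k : fieldType) (G : affineGroup k).
Local Notation O := (coordRing G).

Definition comod_in (X : {pred O}) (M : gmodule G) : Prop :=
  forall m, tens_in (predT : {pred M}) X (coact M m).

Variables (X : {pred O}) (M : gmodule G).

Lemma gsub_comod_inP (N : submodClosed M) (hN : gstable N) :
  comod_in X (gsub hN) <-> {in N, forall m, tens_in N X (coact M m)}.
Proof.
split=> [h m Nm|h n].
  have [s sX ds] := h (exist (fun m => m \in N) m Nm : subsp N).
  exists [seq (val p.1, p.2) | p <- s].
    by move=> _ /mapP[p /sX[_ Xp] ->]; split=> //=; apply: valP.
  rewrite big_map -(sub_coactE hN (exist (fun m => m \in N) m Nm : subsp N)).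
  rewrite [X in tmap _ _ X]ds (linear_sum (tmap \val idfun)); apply: eq_bigr => p _.
  exact: tmap_tens.
have [s sX ds] := h (val n) (valP n).
exists [seq (insubd (0 : subsp N) p.1, p.2) | p <- s].
  by move=> _ /mapP[p /sX[_ Xp] ->].
apply: (tmap_val_inj (N := N)); rewrite [LHS](sub_coactE hN) [LHS]ds big_map.
rewrite (linear_sum (tmap \val idfun)); apply: eq_big_seq => p /sX[Np _].
by rewrite [RHS](tmap_tens \val idfun) -[in LHS](insubdK (0 : subsp N) Np).
Qed.

Definition xpart_pred : {pred M} := fun m =>
  `[< exists (N : submodClosed M) (hN : gstable N),
        comod_in X (gsub hN) /\ m \in N >].

Lemma tens_in_stable (N : {pred M}) :
  {in N, forall m, tens_in N X (coact M m)} -> gstable N.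
Proof.
by move=> h m /h[s sX ->]; exists s => // p /sX[].
Qed.

Lemma xpart_predP m : reflect
  (exists N : submodClosed M,
     {in N, forall m, tens_in N X (coact M m)} /\ m \in N)
  (m \in xpart_pred).
Proof.
apply: (iffP (asboolP _)) => [[N [hN [/gsub_comod_inP h Nm]]]|[N [h Nm]]].
  by exists N.
by exists N, (tens_in_stable h); split=> //; apply/gsub_comod_inP.
Qed.

Fact xpart_closed : subsemimod_closed xpart_pred.
Proof.
split; first split.
- apply/xpart_predP; exists (@zero_subsp k M : submodClosed M); split; last by rewrite inE.
  by move=> m /eqP ->; exists [::] => //; rewrite linear0 big_nil.
- move=> m m' /xpart_predP[N [h Nm]] /xpart_predP[N' [h' Nm']].
  apply/xpart_predP; exists (add_subsp N N' : submodClosed M); split; last first.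
    by apply/asboolP; exists m, m'.
  move=> _ /asboolP[n [n' [/h[s sX dn] /h'[s' sX' dn'] ->]]].
  exists (s ++ s'); last by rewrite linearD dn dn' big_cat.
  move=> p; rewrite mem_cat => /orP[/sX|/sX'] [Np Xp]; split=> //;
    apply/asboolP.
    by exists p.1, 0; rewrite rpred0 addr0.
  by exists 0, p.1; rewrite rpred0 add0r.
- move=> a m /xpart_predP[N [h Nm]]; apply/xpart_predP; exists N.
  by split=> //; apply: rpredZ.
Qed.
HB.instance Definition _ :=
  GRing.isSubmodClosed.Build k M xpart_pred xpart_closed.

Lemma xpart_tens_in : {in xpart_pred, forall m, tens_in xpart_pred X (coact M m)}.
Proof.
move=> m /xpart_predP[N [h /h[s sX ->]]]; exists s => // p /sX[Np Xp].
by split=> //; apply/xpart_predP; exists N.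
Qed.

Fact xpart_stable : gstable xpart_pred.
Proof. exact: tens_in_stable xpart_tens_in. Qed.

(* [M_X], as an object of [Mod(G)]; by [xpart_comod] it lies in [Mod(G, X)]. *)
Definition xpart : gmodule G := gsub xpart_stable.

Lemma xpart_comod : comod_in X xpart.
Proof. exact/gsub_comod_inP/xpart_tens_in. Qed.

Lemma xpart_max (N : submodClosed M) (hN : gstable N) :
  comod_in X (gsub hN) -> {subset N <= xpart_pred}.
Proof. by move=> h m Nm; apply/asboolP; exists N, hN. Qed.

End XComodules.

Section Injectives.
Variables (k : fieldType) (G : affineGroup k).

Definition Mod : gmodule G -> Prop := fun _ => True.

(* A full subcategory of [Mod(G)] is given by the class [C] of its objects;
   that of [Mod(G, X)] is [comod_in X]. *)
Implicit Type C : gmodule G -> Prop.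

Definition mono_in C (M N : gmodule G) (f : ghom M N) : Prop :=
  forall W : gmodule G, C W -> forall g h : ghom W M,
    (f \o g =1 f \o h) -> g =1 h.

Definition injective_in C (L : gmodule G) : Prop :=
  C L /\
  forall (M N : gmodule G) (f : ghom M N) (g : ghom M L),
    C M -> C N -> mono_in C f -> exists h : ghom N L, h \o f =1 g.

End Injectives.

(* Main.v *)
Require Import Defs.
From HB Require Import structures.
From mathcomp Require Import all_boot all_order all_algebra.
From mathcomp Require Import boolp.

Set Implicit Arguments.
Unset Strict Implicit.
Unset Printing Implicit Defensive.

Import GRing.Theory.
Local Open Scope ring_scope.

(** If [L] is injective, then so is [L_X] among [X]-comodules: a monomorphism of
    [X]-comodules is injective, because its kernel is again an [X]-comodule
    ([mono_in_inj]), so a homomorphism to [L_X] extends as a homomorphism to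
    [L]; the image of an [X]-comodule being an [X]-comodule, the extension
    takes its values in [L_X] ([hom_xpart]).

    Conversely, suppose that every [L_{X_i}] is injective among
    [X_i]-comodules, and let [f : M -> N] be an injective homomorphism and
    [g : M -> L] a homomorphism.  Comodules are locally finite, so [N] is the
    union of its submodules [N_{X_i}] ([xpart_exhaustive]).  A homomorphism
    [P -> L] on a submodule [P] of [N] maps [P ∩ N_{X_i}], an [X_i]-comodule,
    to [L_{X_i}]; this restriction extends to [N_{X_i}], whence a homomorphism
    [P + N_{X_i} -> L] ([extend_to_xpart]).  Starting from [P = f(M)] and adding
    [N_{X_0}], [N_{X_1}], and so on, one defines the extension of [g] on all of
    [N].

    The tensor computations rest on the contractions
    [slice phi = id ⊗ phi : U ⊗ V -> U] by linear forms [phi] on [V].  A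
    submodule is stable under the contractions of its coaction, and
    conversely an element of [U ⊗ X] all of whose contractions lie in a
    subset [N] of [U] comes from [N ⊗ X] ([tens_in_slice]).  This shows that
    kernels and intersections of submodules are submodules.  A homomorphism
    defined on a submodule [P] of [N] is represented by a linear map on the
    whole of [N] that is equivariant on [P]. *)

(** * Subspaces and linear maps *)

Section LinearAlgebra.
Variable k : fieldType.
Implicit Types U V W : lmodType k.

Lemma linear_exists U W (f : U -> W) :
  linear f -> exists g : {linear U -> W}, g =1 f.
Proof.
move=> lf.
by exists (HB.pack_for {linear U -> W} f (GRing.isLinear.Build k _ _ _ f lf)).
Qed.

Lemma subspace_exists V (P : V -> Prop) :
  P 0 -> (forall a x y, P x -> P y -> P (a *: x + y)) ->
  exists N : submodClosed V, forall v, v \in N <-> P v.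
Proof.
move=> P0 PL; pose S : {pred V} := fun v => `[< P v >].
have cS : GRing.subsemimod_closed S.
  split; first split.
  - exact/asboolP.
  - move=> x y /asboolP Px /asboolP Py; apply/asboolP.
    by rewrite -[x]scale1r; apply: PL.
  - by move=> a x /asboolP Px; apply/asboolP; rewrite -[_ *: _]addr0; apply: PL.
exists (HB.pack_for (submodClosed V) S (GRing.isSubmodClosed.Build k V S cS)).
by move=> v; split=> /asboolP.
Qed.

Lemma full_subspace V : exists T : submodClosed V, forall v, v \in T.
Proof.
by have [||T TP] := @subspace_exists V (fun=> True); last by exists T => v; apply/TP.
Qed.

Lemma subspaceB V (N : submodClosed V) u v : u \in N -> v \in N -> u - v \in N.
Proof. by move=> Nu Nv; rewrite -scaleN1r rpredD ?rpredZ. Qed.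

Lemma mem_add_subspl V (A B : submodClosed V) : {subset A <= add_subsp A B}.
Proof. by move=> a Aa; apply/asboolP; exists a, 0; rewrite rpred0 addr0. Qed.

Lemma mem_add_subspr V (A B : submodClosed V) : {subset B <= add_subsp A B}.
Proof. by move=> b Bb; apply/asboolP; exists 0, b; rewrite rpred0 add0r. Qed.

(** Two linear maps that agree on [A ∩ B] induce one on [A + B], extended here
    to the whole space. *)
Lemma glue_linear V W (A B : submodClosed V) (f g : {linear V -> W}) :
  (forall v, v \in A -> v \in B -> f v = g v) ->
  exists h : {linear V -> W}, {in A, h =1 f} /\ {in B, h =1 g}.
Proof.
move=> fg; pose C : submodClosed V := add_subsp A B.
have dec (v : subsp C) : exists w, exists a b,
    [/\ a \in A, b \in B, val v = a + b & w = f a + g b].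
  by have /asboolP[a [b [Aa Bb ->]]] := valP v; exists (f a + g b), a, b.
have [h hP] := choice dec.
have hU (v : subsp C) a b : a \in A -> b \in B -> val v = a + b ->
    h v = f a + g b.
  move=> Aa Bb vE; have [a' [b' [Aa' Bb' vE' ->]]] := hP v.
  have ab : a' - a = b - b'.
    have e : a' + b' = a + b by rewrite -vE.
    by rewrite -[a'](addrK b') e addrAC [a + b]addrC addrK.
  apply/eqP; rewrite -subr_eq0 opprD addrACA -!linearB fg.
  - by rewrite ab -linearD addrA subrK subrr linear0.
  - exact: subspaceB.
  - by rewrite ab subspaceB.
have lh : linear h.
  move=> c x y.
  have [a [b [Aa Bb xE ->]]] := hP x; have [a' [b' [Aa' Bb' yE ->]]] := hP y.
  rewrite (hU _ (c *: a + a') (c *: b + b')) ?rpredD ?rpredZ //.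
    by rewrite !linearP scalerDr addrACA.
  by rewrite (linearP \val) /= xE yE scalerDr addrACA.
have [h' h'E] := linear_exists lh; have [r rK] := subsp_retract C.
exists (h' \o r); split=> v Nv /=.
  have Cv : v \in C by apply: mem_add_subspl.
  have -> : r v = exist (fun v => v \in C) v Cv.
    exact: (rK (exist (fun v => v \in C) v Cv)).
  by rewrite h'E (hU _ v 0) ?rpred0 ?addr0 // linear0 addr0.
have Cv : v \in C by apply: mem_add_subspr.
have -> : r v = exist (fun v => v \in C) v Cv.
  exact: (rK (exist (fun v => v \in C) v Cv)).
by rewrite h'E (hU _ 0 v) ?rpred0 ?add0r // linear0 add0r.
Qed.

Lemma extend_linear V W (N : submodClosed V) (f : {linear subsp N -> W}) :
  exists g : {linear V -> W}, forall n, g (val n) = f n.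
Proof.
have [r rK] := subsp_retract N; exists (f \o r) => n /=; by rewrite rK.
Qed.

Lemma extend_linear_inj U V W (i : {linear U -> V}) (f : {linear U -> W}) :
  injective i -> exists g : {linear V -> W}, forall u, g (i u) = f u.
Proof.
move=> inj_i; have [||N NP] := @subspace_exists V (fun v => exists u, i u = v).
- by exists 0; rewrite linear0.
- by move=> a _ _ [u <-] [u' <-]; exists (a *: u + u'); rewrite linearP.
have pre (n : subsp N) : exists u, i u = val n by apply/NP/valP.
have [j jP] := choice pre.
have lfj : linear (f \o j).
  move=> a x y /=; rewrite -linearP; congr (f _); apply: inj_i.
  by rewrite linearP !jP (linearP \val).
have [h hE] := linear_exists lfj; have [g gE] := extend_linear h.
exists g => u; have Nu : i u \in N by apply/NP; exists u.
rewrite -[i u]/(val (exist (fun v => v \in N) _ Nu : subsp N)) gE hE /=.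
by congr (f _); apply: inj_i; rewrite jP.
Qed.

Lemma functional_exists V (w : V) :
  exists phi : {linear V -> k^o}, phi w *: w = w.
Proof.
have [->|w0] := eqVneq w 0; first by exists \0; rewrite scaler0.
pose line (a : k^o) : V := a *: w.
have ll : linear line by move=> a x y; rewrite /line scalerDl -scalerA.
have [l lE] := linear_exists ll.
have inj_l : injective l.
  by move=> a b; rewrite !lE => /eqP; rewrite -subr_eq0 -scalerBl scaler_eq0
    (negPf w0) orbF subr_eq0 => /eqP.
have [phi phiE] := extend_linear_inj (idfun : {linear k^o -> k^o}) inj_l.
by exists phi; have := phiE 1; rewrite lE /line /= scale1r => ->; rewrite scale1r.
Qed.

(** Finitely many vectors of [X] can be written through finitely many pairs of a
    vector [e] of [X] and a linear form [phi], as [v = \sum phi(v) e].  The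
    vectors [e] need not be independent, nor the forms dual to them. *)
Lemma coordinates_exist V (X : submodClosed V) (t : seq V) :
  {subset t <= X} ->
  exists2 s : seq (V * {linear V -> k^o}), all (fun p => p.1 \in X) s &
    {in t, forall v, \sum_(p <- s) p.2 v *: p.1 = v}.
Proof.
elim: t => [|v t IH] tX; first by exists [::].
have [|s sX sP] := IH; first by move=> x tx; apply: tX; rewrite inE tx orbT.
(* The new pair is the part of v not yet captured, with a form that is 1 on it
   if it is not zero, composed with rest so as to vanish on t. *)
pose rest x := x - \sum_(p <- s) p.2 x *: p.1.
have lrest : linear rest.
  move=> a x y; rewrite /rest scalerBr addrACA -opprD; congr (_ - _).
  rewrite scaler_sumr -big_split; apply: eq_bigr => p _ /=.
  by rewrite linearP scalerDl -scalerA.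
have [r rE] := linear_exists lrest.
have [psi psiE] := functional_exists (r v).
exists ((r v, psi \o r : {linear V -> k^o}) :: s).
  rewrite /= sX andbT rE subspaceB ?(tX v) ?mem_head //.
  elim: s sX {sP rest lrest r rE psi psiE} => [|p s IHs] /=.
    by rewrite big_nil rpred0.
  by move=> /andP[Xp /IHs Xs]; rewrite big_cons rpredD ?rpredZ.
move=> x; rewrite inE big_cons /= => /orP[/eqP ->|tx].
  by rewrite psiE rE /rest subrK.
by rewrite [r x]rE /rest sP // subrr linear0 scale0r add0r.
Qed.

End LinearAlgebra.

(** * Contraction of tensors against a linear form *)

Section Slices.
Variable k : fieldType.
Implicit Types U V W : lmodType k.

Lemma bilin_slice U V (phi : {linear V -> k^o}) :
  bilin (fun (u : U) v => phi v *: u).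
Proof.
split=> [v|u] a x y /=; first by rewrite scalerDr !scalerA mulrC.
by rewrite linearP /= scalerDl scalerA.
Qed.

(** The map [id ⊗ phi : U ⊗ V -> U] for a linear form [phi] on [V]. *)
Definition slice U V (phi : {linear V -> k^o}) : tensor U V -> U :=
  tlift (fun u v => phi v *: u).

HB.instance Definition _ U V (phi : {linear V -> k^o}) :=
  GRing.isLinear.Build k (tensor U V) U *:%R (@slice U V phi)
    (tlift_linear (bilin_slice U phi)).

Lemma slice_tens U V (phi : {linear V -> k^o}) (u : U) v :
  slice phi (tens u v) = phi v *: u.
Proof. exact: tlift_tens (bilin_slice U phi). Qed.

Lemma tens_suml U V (I : Type) (s : seq I) (F : I -> U) (v : V) :
  tens (\sum_(i <- s) F i) v = \sum_(i <- s) tens (F i) v.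
Proof.
apply: (big_morph (fun u => tens u v)) => [u u'|]; last exact: tens0l.
exact: bilinDl (tens_bilin U V) _ _ _.
Qed.

Lemma tens_sumr U V (I : Type) (s : seq I) (F : I -> V) (u : U) :
  tens u (\sum_(i <- s) F i) = \sum_(i <- s) tens u (F i).
Proof.
apply: (big_morph (tens u)) => [v v'|].
  exact: bilinDr (tens_bilin U V) _ _ _.
by have := bilinZr (tens_bilin U V) 0 u 0; rewrite !scale0r.
Qed.

Lemma slice_tmap U U' V (phi : {linear V -> k^o}) (f : {linear U -> U'})
    (x : tensor U V) : slice phi (tmap f idfun x) = f (slice phi x).
Proof.
apply: (tlift_uniq (f := slice phi \o tmap f idfun) (g := f \o slice phi)).
by move=> u v /=; rewrite tmap_tens /= !slice_tens linearZ.
Qed.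

Lemma slice_tassoc U V W (phi : {linear W -> k^o})
    (x : tensor (tensor U V) W) :
  slice phi x = tmap idfun (slice phi) (tassoc x).
Proof.
have sD (y z : tensor (tensor U V) W) :
    slice phi (y + z) = slice phi y + slice phi z by exact: linearD.
have aD (y z : tensor (tensor U V) W) : tassoc (y + z) = tassoc y + tassoc z.
  exact: linearD.
have mD (y z : tensor U (tensor V W)) :
    tmap idfun (slice phi) (y + z)
    = tmap idfun (slice phi) y + tmap idfun (slice phi) z :> tensor U V.
  exact: linearD.
elim/tens_ind: x => [|y w|x y hx hy]; first by rewrite !linear0.
  elim/tens_ind: y => [|u v|x y hx hy].
  - by rewrite tens0l !linear0.
  - rewrite tassoc_tens (tmap_tens idfun (slice phi)) /= !slice_tens.
    by rewrite (bilinZr (tens_bilin U V)).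
  - by rewrite (bilinDl (tens_bilin _ _)) sD hx hy aD mD.
by rewrite sD hx hy aD mD.
Qed.

Lemma tens_inS U V (N N' : {pred U}) (X X' : {pred V}) (x : tensor U V) :
  {subset N <= N'} -> {subset X <= X'} -> tens_in N X x -> tens_in N' X' x.
Proof.
by move=> NN' XX' [s sX ->]; exists s => // p /sX[/NN' ? /XX' ?].
Qed.

Lemma tens_inT U V (x : tensor U V) : tens_in predT predT x.
Proof. by exists (repr x) => //; apply: tensE. Qed.

Lemma slice_in U V (N : submodClosed U) (X : {pred V}) phi (x : tensor U V) :
  tens_in N X x -> slice phi x \in N.
Proof.
move=> [s sN ->]; rewrite linear_sum big_seq rpred_sum // => p /sN[Np _].
by rewrite /= slice_tens rpredZ.
Qed.

Lemma slice_decomp U V (N : {pred U}) (X : submodClosed V) (x : tensor U V) :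
  tens_in N X x ->
  exists2 s : seq (V * {linear V -> k^o}), all (fun p => p.1 \in X) s &
    x = \sum_(p <- s) tens (slice p.2 x) p.1.
Proof.
move=> [t tX ->].
have [|s sX sP] := @coordinates_exist k V X [seq q.2 | q <- t].
  by move=> _ /mapP[q /tX[_ Xq] ->].
exists s => //; under [RHS]eq_bigr => p _ do rewrite linear_sum tens_suml.
rewrite exchange_big /=; apply: eq_big_seq => q tq.
rewrite -{1}(sP q.2) ?map_f // tens_sumr; apply: eq_bigr => p _.
by rewrite slice_tens (bilinZl (tens_bilin U V)) (bilinZr (tens_bilin U V)).
Qed.

(** Once a tensor lies in [U ⊗ X], its membership in [N' ⊗ X] can be tested on
    its contractions. *)
Lemma tens_in_slice U V (N N' : {pred U}) (X : submodClosed V)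
    (x : tensor U V) :
  tens_in N X x -> (forall phi : {linear V -> k^o}, slice phi x \in N') ->
  tens_in N' X x.
Proof.
move=> /slice_decomp[s sX xE] xN'.
exists [seq (slice p.2 x, p.1) | p <- s]; last by rewrite big_map.
have H : all (fun q : U * V => (q.1 \in N') && (q.2 \in X))
    [seq (slice p.2 x, p.1) | p <- s].
  by rewrite all_map; apply: sub_all sX => p /= ->; rewrite xN'.
by move=> q /(allP H)/andP.
Qed.

End Slices.

(** * Submodules and partially defined homomorphisms *)

Section Comodules.
Variables (k : fieldType) (G : affineGroup k).
Local Notation O := (coordRing G).
Implicit Types M N L : gmodule G.

Lemma comod_in_sliceP M (P : {pred M}) (X : submodClosed O) :
  comod_in X M ->
  (forall m (phi : {linear O -> k^o}), m \in P -> slice phi (coact M m) \in P) ->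
  {in P, forall m, tens_in P X (coact M m)}.
Proof. by move=> MX hP m Pm; apply: (tens_in_slice (MX m)) => phi; apply: hP. Qed.

Lemma slice_hom M N (f : ghom M N) (phi : {linear O -> k^o}) m :
  slice phi (coact N (f m)) = f (slice phi (coact M m)).
Proof. by rewrite ghom_coact slice_tmap. Qed.

Lemma gstable_slice M (P : submodClosed M) (phi : {linear O -> k^o}) m :
  gstable P -> m \in P -> slice phi (coact M m) \in P.
Proof. by move=> hP /hP; apply: slice_in. Qed.

Lemma gstable_add M (A B : submodClosed M) :
  gstable A -> gstable B -> gstable (add_subsp A B).
Proof.
move=> hA hB _ /asboolP[a [b [Aa Bb ->]]].
have [[s sA aE] [t tB bE]] := (hA _ Aa, hB _ Bb).
exists (s ++ t); last by rewrite linearD aE bE big_cat.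
move=> q; rewrite mem_cat => /orP[/sA|/tB] [Nq _]; split=> //.
  exact: mem_add_subspl.
exact: mem_add_subspr.
Qed.

Lemma hom_image_stable M N (f : ghom M N) (X : {pred O}) (P : {pred N}) m :
  (forall m, f m \in P) -> tens_in predT X (coact M m) ->
  tens_in P X (coact N (f m)).
Proof.
move=> fP [s sX mE]; exists [seq (f q.1, q.2) | q <- s].
  by move=> _ /mapP[q /sX[_ Xq] ->]; split=> //=; apply: fP.
rewrite ghom_coact mE (linear_sum (tmap f idfun)) big_map.
by apply: eq_bigr => q _; apply: tmap_tens.
Qed.

(** The image of an [X]-comodule is an [X]-comodule, hence lies in [L_X]. *)
Lemma hom_xpart M L (X : {pred O}) (f : ghom M L) m :
  comod_in X M -> f m \in @xpart_pred k G X L.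
Proof.
move=> MX; have [||P PP] := @subspace_exists k L (fun l => exists m, f m = l).
- by exists 0; rewrite linear0.
- by move=> a _ _ [u <-] [v <-]; exists (a *: u + v); rewrite linearP.
apply/xpart_predP; exists P; split; last by apply/PP; exists m.
move=> l /PP[n <-]; apply: hom_image_stable (MX n) => u.
by apply/PP; exists u.
Qed.

(** The inclusion of a submodule, as a homomorphism of [G]-modules. *)
Definition gincl M (P : submodClosed M) (hP : gstable P) : ghom (gsub hP) M :=
  @GHom k G (gsub hP) M (\val : {linear subsp P -> M})
    (fun n => esym (sub_coactE hP n)).

Lemma corestrict_hom M L (P : submodClosed L) (hP : gstable P)
    (f : ghom M L) : (forall m, f m \in P) ->
  exists g : ghom M (gsub hP), forall m, val (g m : subsp P) = f m.
Proof.
move=> fP; pose g m : subsp P := exist (fun l => l \in P) (f m) (fP m).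
have lg : linear g.
  by move=> a x y; apply: val_inj; rewrite (linearP \val) /= linearP.
have [h hE] := linear_exists lg.
have vhE m : val (h m) = f m by rewrite hE.
have hC m : coact (gsub hP) (h m) = tmap h idfun (coact M m).
  apply: (tmap_val_inj (N := P)).
  rewrite [LHS](sub_coactE hP) vhE ghom_coact.
  rewrite [RHS](tmap_comp h idfun (\val : {linear subsp P -> L}) idfun).
  by apply: eq_tmap => // u /=; rewrite vhE.
by exists (@GHom k G M (gsub hP) h hC).
Qed.

(** [f] restricts to a homomorphism of [G]-modules on [P]: this is the meaning
    when [P] is a submodule. *)
Definition equivariant_on N L (P : {pred N}) (f : {linear N -> L}) : Prop :=
  {in P, forall n, coact L (f n) = tmap f idfun (coact N n)}.

Lemma equivariant_hom N L (P : submodClosed N) (hP : gstable P)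
    (f : {linear N -> L}) : equivariant_on P f ->
  exists g : ghom (gsub hP) L, forall n : subsp P, g n = f (val n).
Proof.
move=> fP; pose h : {linear subsp P -> L} := f \o (\val : {linear subsp P -> N}).
have hC (n : gsub hP) : coact L (h n) = tmap h idfun (coact (gsub hP) n).
  rewrite /h /= fP ?(valP (n : subsp P)) // -(sub_coactE hP).
  exact: (tmap_comp (\val : {linear subsp P -> N}) idfun f idfun).
by exists (@GHom k G (gsub hP) L h hC).
Qed.

Lemma hom_equivariant N L (P : submodClosed N) (hP : gstable P)
    (g : ghom (gsub hP) L) (f : {linear N -> L}) :
  (forall n : subsp P, f (val n) = g n) -> equivariant_on P f.
Proof.
move=> fg n Pn; pose n' : subsp P := exist (fun n => n \in P) n Pn.
rewrite -[n]/(val n') fg ghom_coact -(sub_coactE hP).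
rewrite [RHS](tmap_comp (\val : {linear subsp P -> N}) idfun f idfun).
by apply: eq_tmap => // u /=; rewrite fg.
Qed.

Lemma eq_equivariant_on N L (P : {pred N}) (f g : {linear N -> L}) :
  gstable P -> {in P, f =1 g} -> equivariant_on P f -> equivariant_on P g.
Proof.
move=> hP fg fP n Pn; rewrite -fg // fP //.
have [s sP ->] := hP n Pn.
rewrite (linear_sum (tmap f idfun)) (linear_sum (tmap g idfun)).
apply: eq_big_seq => q /sP[Pq _] /=.
by rewrite (tmap_tens f idfun) (tmap_tens g idfun) /= fg.
Qed.

Lemma equivariant_on_add N L (A B : submodClosed N) (f : {linear N -> L}) :
  equivariant_on A f -> equivariant_on B f -> equivariant_on (add_subsp A B) f.
Proof.
move=> fA fB _ /asboolP[a [b [Aa Bb ->]]].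
rewrite !linearD fA // fB // (linearD (tmap f idfun)); congr (_ + _).
Qed.

(** * Monomorphisms and injectivity of homomorphisms *)

Lemma tmap0l (U U' V : lmodType k) (x : tensor U V) :
  tmap (\0 : {linear U -> U'}) (idfun : V -> V) x = 0.
Proof. by rewrite /tmap /tlift /bsum big1 // => q _; rewrite tens0l. Qed.

(** The kernel of a homomorphism between [X]-comodules is an [X]-comodule, so a
    monomorphism in any full subcategory containing these is injective. *)
Lemma mono_in_inj (C : gmodule G -> Prop) (X : submodClosed O) M N
    (f : ghom M N) :
  comod_in X M -> (forall W, comod_in X W -> C W) -> mono_in C f ->
  injective f.
Proof.
move=> MX XC fm; have [||K KP] := @subspace_exists k M (fun m => f m = 0).
- by rewrite linear0.
- by move=> a x y fx fy; rewrite linearP fx fy scaler0 addr0.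
have KX : {in K, forall m, tens_in K X (coact M m)}.
  apply: (comod_in_sliceP MX) => m phi /KP fm0; apply/KP.
  by rewrite -slice_hom fm0 !linear0.
pose hK := tens_in_stable KX.
have z0 (n : gsub hK) : coact M ((\0 : {linear gsub hK -> M}) n) =
    tmap (\0 : {linear gsub hK -> M}) idfun (coact (gsub hK) n).
  by rewrite [RHS]tmap0l linear0.
move=> x y fxy; apply/eqP; rewrite -subr_eq0; apply/eqP.
have Kxy : x - y \in K by apply/KP; rewrite linearB fxy subrr.
have CK : C (gsub hK) by apply/XC/gsub_comod_inP.
apply: (fm _ CK (gincl hK) (GHom z0) _ (exist (fun m => m \in K) _ Kxy)).
by move=> n /=; rewrite linear0; apply/KP/valP.
Qed.

Lemma inj_mono_in (C : gmodule G -> Prop) M N (f : ghom M N) :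
  injective f -> mono_in C f.
Proof. by move=> fi W _ g h fgh w; apply/fi/fgh. Qed.

(** * Injectivity of a module and of its largest comodules *)

Lemma injective_xpart (X : submodClosed O) L :
  injective_in (@Mod k G) L -> injective_in (comod_in X) (xpart X L).
Proof.
move=> [_ Linj]; split; first exact: xpart_comod.
move=> M N f g MX NX fm.
have fi : injective f by apply: (mono_in_inj MX _ fm).
pose i := gincl (@xpart_stable k G X L).
have igC m : coact L ((i \o g) m) = tmap (i \o g) idfun (coact M m).
  rewrite /= [LHS](ghom_coact i) [X in tmap _ _ X](ghom_coact g).
  exact: tmap_comp.
have [h hf] := Linj M N f (GHom igC) I I (inj_mono_in fi).
have [|h' h'E] := corestrict_hom (@xpart_stable k G X L) (f := h).
  by move=> n; apply: hom_xpart.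
by exists h' => m; apply: val_inj; rewrite /= h'E; apply: hf.
Qed.

(** Local finiteness: the submodule generated by [n] consists of the
    contractions of the coaction on [n], and the coefficients of all of them are
    contractions of finitely many elements of [O ⊗ O]. *)
Lemma xpart_exhaustive (X : nat -> submodClosed O) N (n : N) :
  (forall i, {subset X i <= X i.+1}) -> (forall f, exists i, f \in X i) ->
  exists i, n \in @xpart_pred k G (X i) N.
Proof.
move=> Xasc Xcvg; have [T TT] := full_subspace O.
have Xmono i j : (i <= j)%N -> {subset X i <= X j}.
  move=> /subnKC <-; elim: (j - i)%N => [|d IH]; first by rewrite addn0.
  by move=> f /IH; rewrite addnS; apply: Xasc.
have Xtens (x : tensor O O) : exists i, tens_in (X i) predT x.
  elim/tens_ind: x => [|a b|x y [i [s sX ->]] [j [t tX ->]]].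
  - by exists 0%N, [::]; rewrite ?big_nil.
  - have [i Xa] := Xcvg a; exists i, [:: (a, b)]; last by rewrite big_seq1.
    by move=> q; rewrite inE => /eqP ->.
  exists (maxn i j), (s ++ t); last by rewrite big_cat.
  move=> q; rewrite mem_cat => /orP[/sX|/tX] [Xq _]; split=> //.
    exact: Xmono (leq_maxl i j) _ Xq.
  exact: Xmono (leq_maxr i j) _ Xq.
have [|s _ nE] := @slice_decomp k N O predT T (coact N n).
  by apply: tens_inS (tens_inT _).
have [i iX] : exists i, all (fun q => `[< tens_in (X i) predT (comul G q.1) >]) s.
  elim: s {nE} => [|q s [i iX]]; first by exists 0%N.
  have [j jX] := Xtens (comul G q.1); exists (maxn i j) => /=; apply/andP; split.
    by apply/asboolP; apply: tens_inS jX => //; apply/Xmono/leq_maxr.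
  apply: sub_all iX => r /asboolP rX; apply/asboolP.
  by apply: tens_inS rX => //; apply/Xmono/leq_maxl.
exists i; apply/xpart_predP.
(* S is the submodule generated by n. *)
have [||S SP] := @subspace_exists k N
    (fun m => exists phi : {linear O -> k^o}, slice phi (coact N n) = m).
- by exists \0; rewrite /slice /tlift /bsum big1 // => q _; rewrite scale0r.
- move=> a _ _ [phi <-] [psi <-]; exists (a \*: phi \+ psi).
  rewrite /slice /tlift /bsum scaler_sumr -big_split; apply: eq_bigr => q _ /=.
  by rewrite scalerDl -scalerA.
exists S; split=> [_ /SP[phi <-]|]; last first.
  (* n itself is the contraction by the counit. *)
  by apply/SP; exists (counit G); apply: coact_counit.
(* By coassociativity, the coaction on (id ⊗ phi)(coact n) is obtained by
   applying id ⊗ (id ⊗ phi) ∘ comul to coact n. *)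
have E : coact N (slice phi (coact N n)) =
    \sum_(q <- s) tens (slice q.2 (coact N n)) (slice phi (comul G q.1)).
  rewrite -slice_tmap slice_tassoc coactA tmap_comp {1}nE.
  rewrite (linear_sum (tmap idfun (slice phi \o comul G))).
  by apply: eq_bigr => q _; apply: tmap_tens.
exists [seq (slice q.2 (coact N n), slice phi (comul G q.1)) | q <- s].
  have H : all (fun q : N * O => (q.1 \in S) && (q.2 \in X i))
      [seq (slice q.2 (coact N n), slice phi (comul G q.1)) | q <- s].
    rewrite all_map; apply: sub_all iX => q /asboolP qX /=.
    by rewrite (slice_in phi qX) andbT; apply/SP; exists q.2.
  by move=> q /(allP H)/andP.
by rewrite big_map.
Qed.

(** A homomorphism on [P] restricts to [P ∩ N_X -> L_X], which extends to
    [N_X -> L_X]; the two homomorphisms glue to one on [P + N_X]. *)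
Lemma extend_to_xpart (X : submodClosed O) N L (P : submodClosed N)
    (f : {linear N -> L}) :
  injective_in (comod_in X) (xpart X L) -> gstable P -> equivariant_on P f ->
  exists f' : {linear N -> L},
    equivariant_on (add_subsp P (@xpart_pred k G X N)) f' /\ {in P, f' =1 f}.
Proof.
move=> [_ Linj] hP fP; set NX : submodClosed N := @xpart_pred k G X N.
have [||Q QP] := @subspace_exists k N (fun n => n \in P /\ n \in NX).
- by rewrite !rpred0.
- by move=> a x y [Px Nx] [Py Ny]; rewrite !rpredD ?rpredZ.
have QX : {in Q, forall n, tens_in Q X (coact N n)}.
  move=> n /QP[Pn Nn]; have nX := xpart_tens_in Nn.
  apply: (tens_in_slice nX) => phi; apply/QP; split.
    exact: gstable_slice.
  exact: slice_in nX.
pose hQ := tens_in_stable QX.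
have fQ : equivariant_on Q f by move=> n /QP[Pn _]; apply: fP.
have [g gE] := equivariant_hom hQ fQ.
have QC : comod_in X (gsub hQ) by apply/gsub_comod_inP.
have [|g' g'E] := corestrict_hom (@xpart_stable k G X L) (f := g).
  by move=> n; apply: hom_xpart.
have [|j jE] := corestrict_hom (@xpart_stable k G X N) (f := gincl hQ).
  by move=> n; have /QP[] := valP (n : subsp Q).
have ji : injective j.
  by move=> u v uv; apply: val_inj; rewrite -[LHS]jE -[RHS]jE uv.
have [h hE] := Linj _ _ j g' QC (@xpart_comod k G X N) (inj_mono_in ji).
pose ih : {linear subsp NX -> L} :=
  (\val : {linear subsp (@xpart_pred k G X L) -> L}) \o h.
have ihC (n : xpart X N) : coact L (ih n) = tmap ih idfun (coact (xpart X N) n).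
  rewrite /ih /= [LHS](ghom_coact (gincl (@xpart_stable k G X L))).
  rewrite [X in tmap _ _ X](ghom_coact h); exact: tmap_comp.
have [e eE] := extend_linear ih.
have eNX : equivariant_on NX e by apply: (hom_equivariant (g := GHom ihC)).
have [n Pn Nn|f' [f'P f'N]] := @glue_linear k N L P NX f e.
  have Qn : n \in Q by apply/QP.
  pose n' : subsp Q := exist (fun n => n \in Q) n Qn.
  have nE : n = val (j n' : subsp NX) by rewrite jE.
  have fE : f n = val (g' n' : subsp (@xpart_pred k G X L)) by rewrite g'E gE.
  by rewrite fE -(hE n') [in RHS]nE eE.
exists f'; split=> //; apply: equivariant_on_add.
  by apply: eq_equivariant_on fP => // n Pn; rewrite f'P.
apply: eq_equivariant_on eNX => [|n Nn]; first exact: xpart_stable.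
by rewrite f'N.
Qed.

Lemma injective_of_xpart (X : nat -> submodClosed O) L :
  (forall i, {subset X i <= X i.+1}) -> (forall f, exists i, f \in X i) ->
  (forall i, injective_in (comod_in (X i)) (xpart (X i) L)) ->
  injective_in (@Mod k G) L.
Proof.
move=> Xasc Xcvg Linj; split=> // M N f g _ _ fm.
have [T TT] := full_subspace O.
have fi : injective f.
  by apply: (mono_in_inj (X := T) _ _ fm) => // m; apply: tens_inS (tens_inT _).
have [g0 g0E] := extend_linear_inj g fi.
have [||P0 P0P] := @subspace_exists k N (fun n => exists m, f m = n).
- by exists 0; rewrite linear0.
- by move=> a _ _ [u <-] [v <-]; exists (a *: u + v); rewrite linearP.
have hP0 : gstable P0.
  move=> _ /P0P[m <-]; apply: hom_image_stable (tens_inT _) => u.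
  by apply/P0P; exists u.
have g0P : equivariant_on P0 g0.
  move=> _ /P0P[m <-]; rewrite g0E !ghom_coact.
  rewrite [RHS](tmap_comp f idfun g0 idfun).
  by apply: eq_tmap => // u /=; rewrite g0E.
(* A partial extension is a submodule of N with a linear map equivariant on it;
   step i adds N_{X_i} to the submodule. *)
pose state := {s : submodClosed N * {linear N -> L} |
  gstable s.1 /\ equivariant_on s.1 s.2}.
have step (u : nat * state) : exists s' : state,
    (sval s').1 = add_subsp (sval u.2).1 (@xpart_pred k G (X u.1) N)
    /\ {in (sval u.2).1, (sval s').2 =1 (sval u.2).2}.
  case: u => i [[P e] /= [hP eP]].
  have [e' [e'P e'E]] := extend_to_xpart (Linj i) hP eP.
  have hP' := gstable_add hP (@xpart_stable k G (X i) N).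
  by exists (exist (fun s : submodClosed N * {linear N -> L} =>
    gstable s.1 /\ equivariant_on s.1 s.2)
    (add_subsp P (@xpart_pred k G (X i) N) : submodClosed N, e') (conj hP' e'P)).
have [nxt nxtP] := choice step.
pose st := fix st i : state :=
  if i is j.+1 then nxt (j, st j) else exist _ (P0, g0) (conj hP0 g0P).
pose P i := (sval (st i)).1; pose e i := (sval (st i)).2.
have hP i : gstable (P i) by exact: (svalP (st i)).1.
have eP i : equivariant_on (P i) (e i) by exact: (svalP (st i)).2.
have PS i : P i.+1 = add_subsp (P i) (@xpart_pred k G (X i) N).
  exact: (nxtP (i, st i)).1.
have eS i : {in P i, e i.+1 =1 e i} by exact: (nxtP (i, st i)).2.
have Pmono i j : (i <= j)%N -> {subset P i <= P j}.
  move=> /subnKC <-; elim: (j - i)%N => [|d IH]; first by rewrite addn0.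
  by move=> n /IH; rewrite addnS PS; apply: mem_add_subspl.
have emono i j : (i <= j)%N -> {in P i, e j =1 e i}.
  move=> /subnKC <-; elim: (j - i)%N => [|d IH] n Pn; first by rewrite addn0.
  by rewrite addnS eS ?IH // (Pmono i) // leq_addr.
have Pall n : exists i, n \in P i.
  have [i Nn] := xpart_exhaustive n Xasc Xcvg.
  by exists i.+1; rewrite PS; apply: mem_add_subspr.
(* The extension is given at n by any stage whose submodule contains n. *)
have [idx idxP] := choice Pall.
pose h n := e (idx n) n.
have hE i n : n \in P i -> h n = e i n.
  move=> Pn; have [ij|/ltnW ji] := leqP i (idx n).
    exact: emono.
  by rewrite (emono _ _ ji).
have lh : linear h.
  move=> a x y; pose i := maxn (idx x) (idx y).
  have Px : x \in P i by apply: Pmono (idxP x); apply: leq_maxl.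
  have Py : y \in P i by apply: Pmono (idxP y); apply: leq_maxr.
  by rewrite !(hE i) ?rpredD ?rpredZ // linearP.
have [h' h'E] := linear_exists lh.
have h'C n : coact L (h' n) = tmap h' idfun (coact N n).
  apply: (eq_equivariant_on (hP (idx n)) _ (eP (idx n)) (idxP n)) => m Pm.
  by rewrite h'E (hE _ _ Pm).
exists (GHom h'C) => m /=.
by rewrite h'E (hE 0%N) ?g0E //; apply/P0P; exists m.
Qed.

End Comodules.

Theorem proposition2p9 (k : fieldType) (p : nat) (char_k : p \in [pchar k])
    (G : affineGroup k) (finG : finite_type G)
    (X : nat -> submodClosed (coordRing G))
    (X_ascending : forall i, {subset X i <= X i.+1})
    (X_converging : forall f : coordRing G, exists i, f \in X i)
    (L : gmodule G) :
  injective_in (@Mod k G) L <->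
  forall i, injective_in (comod_in (X i)) (xpart (X i) L).
Proof.
split=> [Linj i|Linj]; first exact: injective_xpart.
exact: injective_of_xpart X_ascending X_converging Linj.
Qed.
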